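(* Let $d\ge 2$, let $U$ be a unitary operator on $\mathbb{C}^d$, and let $\Pi=\{\Pi_1,\Pi_2\}$ be a PVM on $\mathbb{C}^d$ such that $\operatorname{rank}\Pi_1=d-1$ and $\operatorname{rank}\Pi_2=1$. Let $z$ be a unit vector that spans $\operatorname{im}\Pi_2$ and put $\Theta:=\operatorname{im}\Pi_1=\operatorname{span}\{z\}^\perp$. Let $\mathbb{P}_*$ be the Kusuoka measure on $\{1,2\}^{\mathbb{N}}$ induced by $U$ and $\Pi$. The following conditions are equivalent: (i) $\mathbb{P}_*$ is not ergodic; (ii) there exists a non-trivial linear subspace of $\mathbb{C}^d$ invariant under $U$ and under $\Pi_2$ (and thus necessarily also under $\Pi_1$); (iii) $z$ belongs to a non-trivial linear subspace of $\mathbb{C}^d$ invariant under $U$; (iv) an eigenvector of $U$ belongs to $\Theta$.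
   Context: A PVM (projection valued measure) $\{\Pi_1,\Pi_2\}$ on $\mathbb{C}^d$ is a pair of non-zero orthogonal projections (self-adjoint idempotents) with $\Pi_1+\Pi_2=\mathbb{I}$. Let $\rho_*:=\mathbb{I}/d$. The Kusuoka measure $\mathbb{P}_*$ induced by $U$ and $\Pi$ is the unique probability measure on $\{1,2\}^{\mathbb{N}}$ (with the $\sigma$-algebra generated by all cylinder sets) such that for every $n\ge 1$ and $(i_1,\ldots,i_n)\in\{1,2\}^n$, $$\mathbb{P}_*(C_{(i_1,\ldots,i_n)})=\operatorname{tr}\left(\Pi_{i_n}U\cdots\Pi_{i_1}U\rho_*U^*\Pi_{i_1}\cdots U^*\Pi_{i_n}\right),$$ where $C_{(i_1,\ldots,i_n)}:=\{(s_j)_{j=1}^\infty : s_1=i_1,\ldots,s_n=i_n\}$. This measure is invariant under the left shift, and ergodicity is understood with respect to the left shift. A subspace of $\mathbb{C}^d$ is non-trivial if it is neither $\{0\}$ nor $\mathbb{C}^d$; a subspace $V$ is invariant under a linear map $A$ if $A(V)\subset V$. *)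

(* Defs.v *)
From HB Require Import structures.
From mathcomp Require Import all_boot all_order all_algebra.
From mathcomp Require Import complex.
From mathcomp Require Import all_classical all_reals all_analysis.

Set Implicit Arguments.
Unset Strict Implicit.
Unset Printing Implicit Defensive.

Import Order.TTheory GRing.Theory Num.Theory.

Local Open Scope classical_set_scope.
Local Open Scope ring_scope.
Local Open Scope sesquilinear_scope.

(* The alphabet {1, 2} is encoded as 'I_2 = {0, 1}: the letters 1 and 2 are    *)
(* (0 : 'I_2) and (1 : 'I_2), and s_(k.+1) is [s k].                           *)

(* [g_sigma_algebraType] is a measurableType only over a pointedType.           *)
HB.instance Definition _ n := isPointed.Build 'I_n.+1 ord0.

Definition cylinder (w : seq 'I_2) : set (nat -> 'I_2) :=
  [set s | forall k, (k < size w)%N -> s k = nth 0 w k].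

Definition path_space : measurableType _ :=
  g_sigma_algebraType (range cylinder).

Definition left_shift (s : path_space) : path_space := fun k => s k.+1.

(* Ergodicity of a measure P that is already known to be T-invariant. *)
Definition ergodic d (X : measurableType d) (R : realType)
    (T : X -> X) (P : probability X R) : Prop :=
  forall A : set X, measurable A -> T @^-1` A = A ->
    P A = 0%E \/ P A = 1%E.

Section Operators.
Variables (R : realType) (d : nat).
Implicit Types (A U rho : 'M[R[i]]_d) (Pi : 'I_2 -> 'M[R[i]]_d).
Implicit Types (z : 'cV[R[i]]_d) (V : {vspace 'cV[R[i]]_d}).

Definition mxop A : 'End('cV[R[i]]_d) := linfun (mulmx A).

Definition op_invariant A V : Prop := (mxop A @: V <= V)%VS.

Definition nontrivial_vspace V : Prop := (V <> 0)%VS /\ (V <> fullv)%VS.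

Definition unit_vector z : Prop := \sum_j `|z j 0| ^+ 2 = 1.

Record is_PVM Pi : Prop := IsPVM {
  pvm_neq0 : forall i, Pi i <> 0;
  pvm_adjoint : forall i, (Pi i) ^t* = Pi i;
  pvm_idem : forall i, Pi i *m Pi i = Pi i;
  pvm_sum : Pi 0 + Pi 1 = 1%:M }.

Definition rho_star : 'M[R[i]]_d := (d%:R)^-1 *: 1%:M.

(* [evolve U Pi rho [:: i_1; ...; i_n]] is                                     *)
(*   Pi_(i_n) U ... Pi_(i_1) U rho U^* Pi_(i_1) ... U^* Pi_(i_n).              *)
Definition evolve U Pi rho (w : seq 'I_2) : 'M[R[i]]_d :=
  foldl (fun r i => Pi i *m U *m r *m U ^t* *m Pi i) rho w.

(* The equation is between complex numbers, so it also asserts that the trace  *)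
(* on the right-hand side is real.                                             *)
Definition is_Kusuoka_measure U Pi (P : probability path_space R) : Prop :=
  forall w : seq 'I_2, (1 <= size w)%N ->
    ((fine (P (cylinder w)))%:C)%C = \tr (evolve U Pi rho_star w).

End Operators.

(* Main.v *)
From HB Require Import structures.
Require Import Defs.
From mathcomp Require Import all_boot all_order all_algebra.
From mathcomp Require Import complex.
From mathcomp Require Import all_classical all_reals all_analysis.
From mathcomp Require Import lra.

(** The letters read off a path are the outcomes of repeatedly applying U and
measuring Pi; Pi_1, Pi_2 and the letters 1, 2 are written [Pi 0], [Pi 1] and 0, 1
in the code.  Averaged over the outcomes, one step is the channel
Phi(X) = sum_k Pi_k U X U^* Pi_k: a unitary conjugation followed by an
orthogonal projection of matrices, hence a contraction for the Hilbert-Schmidt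
norm which preserves the trace and the identity.

(i) -> (ii), by contraposition.  A fixed point of Phi loses no norm, so its
off-diagonal blocks vanish and it commutes with U and both Pi_k
([channel_fixed_commute]).  If U and Pi_2 have no common non-trivial invariant
subspace, an eigenspace argument makes it scalar ([commutant_scalar]).  Phi
preserves the trace, so the scalars meet the image of 1 - Phi only in 0, and
every matrix is a scalar plus a coboundary Y - Phi Y ([coboundary_split]).  The
sums of the iterates of the coboundary telescope and stay bounded, so that
P(C_u and T^-(|u|+j) C_w), which is a linear form in the j-th iterate of the
state after reading u, converges in Cesaro mean to P(C_u) P(C_w).  The left
shift T preserves P, so this passes from cylinders C_w to all events
([pi_system_cvg]); for a shift-invariant event A it says that A is independent
of every cylinder, hence of every event, hence of itself, and P(A) = P(A)^2
([ergodic_of_mixing_in_mean]).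

(ii) -> (iii).  If V is invariant under U and Pi_2 and does not contain z, then
Pi_2 vanishes on V, because its values lie both in V and in the line of z.
So z is orthogonal to V, and the orthogonal complement of V, which is invariant
under the unitary U, can be taken ([mem_or_orthov], [orthov_invariant]).

(iii) -> (iv).  The orthogonal complement of a subspace containing z is
contained in Theta; being invariant under U, it contains an eigenvector
([invariant_eigenvector]).

(iv) -> (i).  Let v be an eigenvector of U in Theta.  The event that from some
time on only the letter 1 occurs is shift-invariant.  By invariance of P it has
the probability of the constant path 1, 1, 1, ...: this is less than 1, since
the letter 2 has positive probability, and it is at least 1/d, since the
projection onto the line of v survives each step with outcome 1
([word_trace_nseq_ge1], [fixed_line_not_ergodic]). *)

Import Order.TTheory GRing.Theory Num.Theory.
Import numFieldNormedType.Exports.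

Local Open Scope ring_scope.

Set Implicit Arguments.
Unset Strict Implicit.
Unset Printing Implicit Defensive.

(** * The Hilbert-Schmidt norm *)

Section HilbertSchmidt.
Local Open Scope sesquilinear_scope.
Variable C : numClosedFieldType.

Lemma adjmxM m n p (A : 'M[C]_(m, n)) (B : 'M[C]_(n, p)) :
  (A *m B)^t* = B^t* *m A^t*.
Proof. by rewrite trmx_mul map_mxM. Qed.

Lemma adjmxB m n (A B : 'M[C]_(m, n)) : (A - B)^t* = A^t* - B^t*.
Proof. by apply/matrixP=> i j; rewrite !mxE rmorphB. Qed.

Lemma adjmxZ m n a (A : 'M[C]_(m, n)) : (a *: A)^t* = a^* *: A^t*.
Proof. by apply/matrixP=> i j; rewrite !mxE rmorphM. Qed.

Lemma adjmx1 n : (1%:M : 'M[C]_n)^t* = 1%:M.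
Proof. by rewrite trmx1 map_mx1. Qed.

Definition sqhsnorm m n (A : 'M[C]_(m, n)) : C := \tr (A *m A^t*).

Lemma sqhsnormE m n (A : 'M[C]_(m, n)) :
  sqhsnorm A = \sum_i \sum_j `|A i j| ^+ 2.
Proof.
apply: eq_bigr => i _; rewrite mxE; apply: eq_bigr => j _.
by rewrite !mxE normCK.
Qed.

Lemma sqhsnorm_ge0 m n (A : 'M[C]_(m, n)) : 0 <= sqhsnorm A.
Proof.
by rewrite sqhsnormE; do 2![apply: sumr_ge0 => ? _]; rewrite exprn_ge0.
Qed.

Lemma entry_le_sqhsnorm m n (A : 'M[C]_(m, n)) i j :
  `|A i j| ^+ 2 <= sqhsnorm A.
Proof.
rewrite sqhsnormE (bigD1 i)//= (bigD1 j)//= -addrA lerDl addr_ge0//.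
  by apply: sumr_ge0 => ? _; rewrite exprn_ge0.
by do 2![apply: sumr_ge0 => ? _]; rewrite exprn_ge0.
Qed.

Lemma sqhsnorm_eq0 m n (A : 'M[C]_(m, n)) : sqhsnorm A = 0 -> A = 0.
Proof.
move=> A0; apply/matrixP => i j; apply/eqP; rewrite mxE -normr_eq0.
by rewrite -sqrf_eq0 eq_le -{1}A0 entry_le_sqhsnorm exprn_ge0.
Qed.

Lemma sqhsnorm_adj m n (A : 'M[C]_(m, n)) : sqhsnorm (A^t*) = sqhsnorm A.
Proof. by rewrite /sqhsnorm trmxCK mxtrace_mulC. Qed.

(** Pythagoras for complementary orthogonal projections acting on the left. *)
Lemma sqhsnorm_proj_split m n (P Q : 'M[C]_m) (A : 'M[C]_(m, n)) :
  P^t* = P -> Q^t* = Q -> P *m P = P -> Q *m Q = Q -> P + Q = 1%:M ->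
  sqhsnorm A = sqhsnorm (P *m A) + sqhsnorm (Q *m A).
Proof.
move=> Pa Qa PP QQ PQ; rewrite /sqhsnorm !adjmxM Pa Qa.
rewrite !mulmxA [\tr (_ *m P)]mxtrace_mulC [\tr (_ *m Q)]mxtrace_mulC.
by rewrite !mulmxA PP QQ -linearD/= -!mulmxDl PQ mul1mx.
Qed.

Lemma unitarymxPV n (U : 'M[C]_n) : U \is unitarymx -> U^t* *m U = 1%:M.
Proof. by move=> uU; rewrite -invmx_unitary// mulVmx// unitarymx_unit. Qed.

Lemma sqhsnorm_unitaryl m n (U : 'M[C]_m) (A : 'M[C]_(m, n)) :
  U \is unitarymx -> sqhsnorm (U *m A) = sqhsnorm A.
Proof.
move=> uU; rewrite /sqhsnorm adjmxM mulmxA mxtrace_mulC.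
by rewrite !mulmxA unitarymxPV// mul1mx.
Qed.

Lemma sqhsnorm_conj n (U A : 'M[C]_n) :
  U \is unitarymx -> sqhsnorm (U *m A *m U^t*) = sqhsnorm A.
Proof.
move=> uU; rewrite -mulmxA sqhsnorm_unitaryl// -sqhsnorm_adj adjmxM trmxCK.
by rewrite sqhsnorm_unitaryl// sqhsnorm_adj.
Qed.


(** A crude continuity estimate: it is stated with the squared norm, which
avoids square roots, and uses x <= 1 + x^2 on each entry. *)
Lemma linear_form_bound m n (f : {scalar 'M[C]_(m, n)}) (A : 'M[C]_(m, n)) :
  `|f A| <= (1 + sqhsnorm A) * \sum_i \sum_j `|f (delta_mx i j)|.
Proof.
rewrite {1}(matrix_sum_delta A) linear_sum (le_trans (ler_norm_sum _ _ _))//.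
rewrite mulr_sumr ler_sum// => i _.
rewrite linear_sum (le_trans (ler_norm_sum _ _ _))// mulr_sumr.
rewrite ler_sum// => j _.
rewrite linearZ /= normrM ler_wpM2r//.
apply: (@le_trans _ _ (1 + `|A i j| ^+ 2)); last first.
  by rewrite lerD2l entry_le_sqhsnorm.
have [a1|a1] := real_leP (normr_real (A i j)) (@real1 C).
  by rewrite (le_trans a1)// lerDl exprn_ge0.
by rewrite ler_wpDl// ler_eXnr// ltW.
Qed.

End HilbertSchmidt.

(** * The quantum channel of the measured dynamics *)

Lemma letterP (k : 'I_2) : k = 0 \/ k = 1.
Proof. by case: k => [[|[|//]] k2]; [left|right]; apply: val_inj. Qed.

Section Channel.
Local Open Scope sesquilinear_scope.
Variables (C : numClosedFieldType) (d : nat).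
Variables (U : 'M[C]_d) (Pi : 'I_2 -> 'M[C]_d).
Hypotheses (uU : U \is unitarymx).
Hypotheses (Pi_adj : forall k, (Pi k)^t* = Pi k).
Hypotheses (Pi_idem : forall k, Pi k *m Pi k = Pi k).
Hypotheses (Pi_sum : Pi 0 + Pi 1 = 1%:M).

Definition kraus (k : 'I_2) (X : 'M[C]_d) : 'M[C]_d :=
  Pi k *m U *m X *m U^t* *m Pi k.

Definition channel (X : 'M[C]_d) : 'M[C]_d := kraus 0 X + kraus 1 X.

Fact kraus_linear k : linear (kraus k).
Proof.
move=> a X Y; rewrite /kraus.
by rewrite !(mulmxDr, mulmxDl) -!(scalemxAr, scalemxAl).
Qed.
HB.instance Definition _ k :=
  GRing.isLinear.Build C 'M[C]_d 'M[C]_d _ (kraus k) (kraus_linear k).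

Fact channel_linear : linear channel.
Proof. by move=> a X Y; rewrite /channel !linearP scalerDr addrACA. Qed.
HB.instance Definition _ :=
  GRing.isLinear.Build C 'M[C]_d 'M[C]_d _ channel channel_linear.

Lemma iter_channelD j X Y :
  iter j channel (X + Y) = iter j channel X + iter j channel Y.
Proof. by elim: j => [//|j IHj]; rewrite !iterS IHj linearD. Qed.

(** For a density matrix X this is the probability of reading the word w when
the system starts in the state X. *)
Definition word_trace w (X : 'M[C]_d) : C :=
  \tr (foldl (fun Y k => kraus k Y) X w).

Fact word_trace_scalar w : scalar (word_trace w).
Proof.
rewrite /word_trace => a.
by elim: w => [|k w IHw] X Y; [exact: linearP | rewrite /= linearP IHw].
Qed.
HB.instance Definition _ w :=
  GRing.isLinear.Build C 'M[C]_d C _ (word_trace w) (word_trace_scalar w).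

Lemma word_trace_cat u w X :
  word_trace (u ++ w) X = word_trace w (foldl (fun Y k => kraus k Y) X u).
Proof. by rewrite /word_trace foldl_cat. Qed.

Lemma pvm_orth i j : i != j -> Pi i *m Pi j = 0.
Proof.
have H a b : Pi a + Pi b = 1%:M -> Pi a *m Pi b = 0.
  move=> /(canRL (addKr _)) ->.
  by rewrite mulmxDr mulmx1 mulmxN Pi_idem addNr.
move: (letterP i) (letterP j).
move=> [->|->] [->|->]// _; apply: H; first exact: Pi_sum.
by rewrite addrC Pi_sum.
Qed.

Lemma sqhsnorm_pvm_split n (A : 'M[C]_(d, n)) :
  sqhsnorm A = sqhsnorm (Pi 0 *m A) + sqhsnorm (Pi 1 *m A).
Proof.
by apply: sqhsnorm_proj_split; rewrite ?Pi_adj ?Pi_idem ?Pi_sum.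
Qed.

Lemma sqhsnorm_pvm_splitr n (A : 'M[C]_(n, d)) :
  sqhsnorm A = sqhsnorm (A *m Pi 0) + sqhsnorm (A *m Pi 1).
Proof.
rewrite -sqhsnorm_adj sqhsnorm_pvm_split -(sqhsnorm_adj (A *m _)).
by rewrite -[sqhsnorm (A *m Pi 1)]sqhsnorm_adj !adjmxM !Pi_adj.
Qed.

Lemma channelE X : channel X =
  Pi 0 *m (U *m X *m U^t*) *m Pi 0 + Pi 1 *m (U *m X *m U^t*) *m Pi 1.
Proof. by rewrite /channel /kraus !mulmxA. Qed.

Lemma pvm_channel i X : Pi i *m channel X = Pi i *m (U *m X *m U^t*) *m Pi i.
Proof.
rewrite channelE mulmxDr !mulmxA.
have [->|->] := letterP i;
  by rewrite Pi_idem pvm_orth// !mul0mx ?addr0 ?add0r.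
Qed.

(** The measurement erases the off-diagonal blocks of U X U^*, and the squared
norm drops by exactly their contribution. *)
Lemma sqhsnorm_channel X :
  sqhsnorm X = sqhsnorm (channel X) +
    (sqhsnorm (Pi 0 *m (U *m X *m U^t*) *m Pi 1) +
     sqhsnorm (Pi 1 *m (U *m X *m U^t*) *m Pi 0)).
Proof.
rewrite -(sqhsnorm_conj X uU) (sqhsnorm_pvm_split (channel X)) !pvm_channel.
rewrite sqhsnorm_pvm_split (sqhsnorm_pvm_splitr (Pi 0 *m _)).
by rewrite (sqhsnorm_pvm_splitr (Pi 1 *m _)) [X in _ + X]addrC addrACA.
Qed.

Lemma sqhsnorm_channel_le X : sqhsnorm (channel X) <= sqhsnorm X.
Proof. by rewrite [leRHS]sqhsnorm_channel lerDl addr_ge0 ?sqhsnorm_ge0. Qed.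

Lemma sqhsnorm_iter_channel n X : sqhsnorm (iter n channel X) <= sqhsnorm X.
Proof.
by elim: n => [//|n]; apply: le_trans; rewrite iterS sqhsnorm_channel_le.
Qed.

(** A fixed point has constant norm, so by [sqhsnorm_channel] the off-diagonal
blocks of U X U^* vanish.  Then U X U^* is not changed by the measurement, and
it is equal to X. *)
Lemma channel_fixed_commute X : channel X = X ->
  U *m X = X *m U /\ forall i, Pi i *m X = X *m Pi i.
Proof.
move=> fX; have := sqhsnorm_channel X.
rewrite fX => /esym/(canRL (addKr _))/eqP.
rewrite addNr paddr_eq0 ?sqhsnorm_ge0// => /andP[/eqP/sqhsnorm_eq0 Y01].
move=> /eqP/sqhsnorm_eq0 Y10.
have XE : X = U *m X *m U^t*.
  rewrite -{1}fX channelE; set Y := U *m X *m U^t* in Y01 Y10 *.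
  rewrite -[RHS]mul1mx -[RHS]mulmx1 -Pi_sum !mulmxDl !mulmxDr.
  by rewrite Y01 Y10 addr0 add0r.
have UX : U *m X = X *m U.
  by rewrite {2}XE -mulmxA unitarymxPV// mulmx1.
split=> // i; rewrite -{1}fX pvm_channel -XE.
have PX : X *m Pi i = Pi i *m X *m Pi i.
  rewrite -{1}fX channelE -XE mulmxDl -!mulmxA.
  have [->|->] := letterP i;
    by rewrite Pi_idem pvm_orth// !mulmx0 ?addr0 ?add0r.
by rewrite PX.
Qed.

Lemma mxtrace_channel X : \tr (channel X) = \tr X.
Proof.
rewrite channelE linearD/= mxtrace_mulC [X in _ + X]mxtrace_mulC.
rewrite !mulmxA !Pi_idem -linearD/= -!mulmxDl Pi_sum mul1mx.
by rewrite mxtrace_mulC mulmxA unitarymxPV// mul1mx.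
Qed.

Lemma channel1 : channel 1%:M = 1%:M.
Proof.
by rewrite channelE !mulmx1 (unitarymxP uU) !mulmx1 !Pi_idem Pi_sum.
Qed.

End Channel.

(** * Invariant subspaces and their orthogonal complements *)

Section InvariantSubspaces.
Variables (C : numClosedFieldType) (d : nat).
Implicit Types (A U X : 'M[C]_d) (V : {vspace 'cV[C]_d}).

Lemma mulmx_invariantP A V :
  (linfun (mulmx A) @: V <= V)%VS <-> (forall v, v \in V -> A *m v \in V).
Proof.
split=> [AV v vV | AV]; last first.
  by apply/subvP => _ /memv_imgP[v vV ->]; rewrite lfunE/=; exact: AV.
have := subvP AV (A *m v); apply.
by have := memv_img (linfun (mulmx A)) vV; rewrite lfunE.
Qed.

(** Irreducibility is asked of U and of one projection P only: a subspace
invariant under P is invariant under 1 - P. *)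
Definition irreducible_pair U P := forall V,
  (linfun (mulmx U) @: V <= V)%VS -> (linfun (mulmx P) @: V <= V)%VS ->
  V = 0%VS \/ V = fullv.

(** Schur's lemma: an eigenspace of X is invariant under everything that
commutes with X, so it is the whole space. *)
Lemma commutant_scalar U P X : (0 < d)%N -> irreducible_pair U P ->
  U *m X = X *m U -> P *m X = X *m P -> exists a, X = a%:M.
Proof.
move=> d0 irr UX PX.
(* [eigenvalue] speaks of row vectors, whence the transposition. *)
have [a /eigenvalueP[v /(congr1 trmx)]] := eigenvalue_closed (X^T) d0.
rewrite trmx_mul trmxK linearZ/= => Xv v0.
exists a; pose V : {vspace 'cV[C]_d} := lker (linfun (mulmx (X - a%:M))).
have memV w : (w \in V) = (X *m w == a *: w).
  by rewrite memv_ker lfunE/= mulmxBl mul_scalar_mx subr_eq0.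
have commV A : A *m X = X *m A -> (linfun (mulmx A) @: V <= V)%VS.
  move=> AX; apply/mulmx_invariantP => w; rewrite !memV => /eqP Xw.
  by rewrite mulmxA -AX -mulmxA Xw -scalemxAr.
have [V0|VT] := irr V (commV _ UX) (commV _ PX).
  have : v^T \in V by rewrite memV Xv.
  by rewrite V0 memv0 trmx_eq0 (negbTE v0).
apply/matrixP => i j.
have : delta_mx j 0 \in V by rewrite VT memvf.
rewrite memV -colE => /eqP/matrixP/(_ i 0).
by rewrite !mxE eqxx andbT mulr_natr.
Qed.

End InvariantSubspaces.

Section Orthogonal.
Local Open Scope sesquilinear_scope.
Variables (C : numClosedFieldType) (d : nat).
Implicit Types (A U : 'M[C]_d) (V : {vspace 'cV[C]_d}) (v w : 'cV[C]_d).

(** The matrix M of the restriction of A to V, in a basis of V, has an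
eigenvector because the field is algebraically closed; its entries are the
coordinates of an eigenvector of A. *)
Lemma invariant_eigenvector A V : V <> 0%VS ->
  (linfun (mulmx A) @: V <= V)%VS ->
  exists a v, [/\ v \in V, v != 0 & A *m v = a *: v].
Proof.
move=> V0 /mulmx_invariantP AV; set n := \dim V; pose b := vbasis V.
have bV i : b`_i \in V.
  have [ib|ib] := ltnP i (size b); first exact/vbasis_mem/mem_nth.
  by rewrite nth_default// mem0v.
pose M : 'M[C]_n := \matrix_(i, j) coord b j (A *m b`_i).
have n0 : (0 < n)%N by rewrite lt0n dimv_eq0; apply/eqP.
have [a /eigenvalueP[r rM r0]] := eigenvalue_closed M n0.
exists a, (\sum_j r 0 j *: b`_j); split.
- by apply: memv_suml => j _; apply: memvZ.
- apply: contra r0 => /eqP r0; apply/eqP/rowP => j; rewrite mxE.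
  by have /freeP/(_ _ r0) := basis_free (vbasisP V).
rewrite mulmx_sumr scaler_sumr.
transitivity (\sum_i \sum_j (r 0 i * M i j) *: b`_j).
  apply: eq_bigr => i _; rewrite -scalemxAr (coord_vbasis (AV _ (bV i))).
  by rewrite scaler_sumr; apply: eq_bigr => j _; rewrite mxE scalerA.
rewrite exchange_big/=; apply: eq_bigr => j _; rewrite -scaler_suml scalerA.
by congr (_ *: _); have /rowP/(_ j) := rM; rewrite !mxE.
Qed.

(** The rows of the matrix are the conjugates of a basis of V, so its kernel is
the orthogonal complement of V. *)
Definition orthov V : {vspace 'cV[C]_d} :=
  lker (linfun (mulmx (\matrix_(i < \dim V, j < d) ((vbasis V)`_i j 0)^*))).

Lemma orthovP V w :
  reflect (forall v, v \in V -> v^t* *m w = 0) (w \in orthov V).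
Proof.
rewrite memv_ker lfunE/=; apply: (iffP eqP) => [w0 v vV|w0].
  rewrite (coord_vbasis vV) raddf_sum/= raddf_sum/= mulmx_suml big1// => i _.
  rewrite adjmxZ -scalemxAl; apply/eqP; rewrite scaler_eq0; apply/orP; right.
  apply/eqP/matrixP => j k; rewrite !ord1; have /colP/(_ i) := w0.
  rewrite !mxE => w0i; rewrite -[RHS]w0i.
  by apply: eq_bigr => l _; rewrite !mxE.
apply/colP => i; have bV : (vbasis V)`_i \in V.
  by apply/vbasis_mem/mem_nth; rewrite size_tuple.
have /matrixP/(_ 0 0) := w0 _ bV; rewrite !mxE => w0i; rewrite -[RHS]w0i.
by apply: eq_bigr => l _; rewrite !mxE.
Qed.

(** At most dim V equations define the complement, and dim V < d. *)
Lemma orthov_neq0 V : V <> fullv -> orthov V <> 0%VS.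
Proof.
move=> VT; rewrite /orthov; set f := linfun _ => f0.
have := limg_ker_dim f fullv; rewrite capfv f0 dimv0 add0n => dimf.
apply: VT; apply/eqP; rewrite eqEdim subvf/= -dimf.
by rewrite (leq_trans (dimvS (subvf _)))// dimvf/= /dim/= muln1.
Qed.

Lemma orthov_neqT V : V <> 0%VS -> orthov V <> fullv.
Proof.
move=> V0 OT; apply: V0; apply/eqP; rewrite -subv0; apply/subvP => v vV.
have /orthovP/(_ v vV) vv : v \in orthov V by rewrite OT memvf.
rewrite memv0; apply/eqP/sqhsnorm_eq0.
by rewrite /sqhsnorm mxtrace_mulC vv linear0.
Qed.

(** U is injective, so it maps V onto V, and U^* is its inverse. *)
Lemma unitary_invariant_adj U V : U \is unitarymx ->
  (linfun (mulmx U) @: V <= V)%VS -> (linfun (mulmx (U^t*)) @: V <= V)%VS.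
Proof.
move=> uU UV; apply/mulmx_invariantP => v vV.
have UK : cancel (mulmx U : 'cV[C]_d -> _) (mulmx (U^t*)).
  by move=> w; rewrite mulmxA unitarymxPV// mul1mx.
have : (linfun (mulmx U) @: V == V)%VS.
  rewrite eqEdim UV/= limg_dim_eq//; apply/eqP; rewrite -subv0.
  apply/subvP => w; rewrite memv_cap memv_ker lfunE/= memv0 => /andP[_ /eqP Uw].
  by rewrite -[w]UK Uw mulmx0.
move=> /eqP UVE; move: vV; rewrite -{1}UVE => /memv_imgP[w wV ->].
by rewrite lfunE/= UK.
Qed.

Lemma orthov_invariant U V : U \is unitarymx ->
  (linfun (mulmx U) @: V <= V)%VS ->
  (linfun (mulmx U) @: orthov V <= orthov V)%VS.
Proof.
move=> uU /(unitary_invariant_adj uU)/mulmx_invariantP UV.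
apply/mulmx_invariantP => w /orthovP wV; apply/orthovP => v vV.
by rewrite mulmxA -{1}[U]trmxCK -adjmxM wV// UV.
Qed.

End Orthogonal.

(** * The mean ergodic theorem for an irreducible channel *)

Section MeanErgodic.
Local Open Scope sesquilinear_scope.
Variables (C : numClosedFieldType) (d : nat).
Variables (U : 'M[C]_d) (Pi : 'I_2 -> 'M[C]_d).
Hypotheses (d_gt0 : (0 < d)%N) (uU : U \is unitarymx).
Hypotheses (Pi_adj : forall k, (Pi k)^t* = Pi k).
Hypotheses (Pi_idem : forall k, Pi k *m Pi k = Pi k).
Hypotheses (Pi_sum : Pi 0 + Pi 1 = 1%:M).
Hypotheses (irr : irreducible_pair U (Pi 1)).
Local Notation Phi := (channel U Pi).

Lemma channel_fixed_scalar X : Phi X = X -> exists a, X = a%:M.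
Proof.
move=> /(channel_fixed_commute uU Pi_adj Pi_idem Pi_sum)[UX PX].
exact: commutant_scalar irr UX (PX 1).
Qed.

(** The kernel of 1 - Phi consists of scalars and its image of matrices of trace
0, so they meet only in 0, and by rank-nullity they span the whole space.  The
scalar part of X is found by taking traces. *)
Lemma coboundary_split X : exists Y, X = (\tr X / d%:R)%:M + (Y - Phi Y).
Proof.
have d0 : d%:R != 0 :> C by rewrite pnatr_eq0 -lt0n.
pose psi : 'End('M[C]_d) := \1%VF - linfun Phi.
have psiE Y : psi Y = Y - Phi Y.
  by rewrite /psi add_lfunE opp_lfunE id_lfunE lfunE.
have tr_psi Y : \tr (psi Y) = 0.
  by rewrite psiE linearB/= mxtrace_channel// subrr.
have ker_scalar Z : Z \in lker psi -> exists a, Z = a%:M.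
  rewrite memv_ker psiE subr_eq0 => /eqP/esym; exact: channel_fixed_scalar.
have disj : (lker psi :&: limg psi = 0)%VS.
  apply/eqP; rewrite -subv0; apply/subvP => Z; rewrite memv_cap memv0.
  move=> /andP[/ker_scalar[a ->] /memv_imgP[Y _ /(congr1 mxtrace)]].
  rewrite tr_psi mxtrace_scalar -mulr_natr => /eqP.
  by rewrite mulf_eq0 (negbTE d0) orbF => /eqP ->; rewrite raddf0.
have full : (lker psi + limg psi = fullv)%VS.
  apply/eqP; rewrite eqEdim subvf dimv_disjoint_sum//=.
  by rewrite -(limg_ker_dim psi fullv) capfv leqnn.
have : X \in (lker psi + limg psi)%VS by rewrite full memvf.
move=> /memv_addP[F /ker_scalar[a ->] [G /memv_imgP[Y _ ->] XE]].
exists Y; rewrite -psiE XE linearD/= tr_psi addr0 mxtrace_scalar.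
by rewrite -[a *+ d]mulr_natr mulfK.
Qed.

Lemma sum_iter_channel X Y N : X = (\tr X / d%:R)%:M + (Y - Phi Y) ->
  \sum_(j < N) iter j Phi X = (\tr X / d%:R)%:M *+ N + (Y - iter N Phi Y).
Proof.
set c := (_ / _)%:M => XE.
have fc : Phi c = c by rewrite /c -scalemx1 linearZ/= channel1.
have iterE j : iter j Phi X = c + (iter j Phi Y - iter j.+1 Phi Y).
  elim: j => [//|j IHj]; rewrite [LHS]iterS IHj linearD/= fc linearB//=.
elim: N => [|N IHN]; first by rewrite big_ord0 mulr0n add0r subrr.
by rewrite big_ord_recr/= IHN iterE/= addrACA -mulrSr subrKA.
Qed.

(** The mean ergodic theorem in the form in which it is used: the sums of the
iterates, seen through a linear form, stay at bounded distance from N times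
their expected mean. *)
Lemma word_trace_mean_bound w X : exists K : C, forall N,
  `|\sum_(j < N) word_trace U Pi w (iter j Phi X) -
    (\tr X / d%:R * word_trace U Pi w 1%:M) *+ N| <= K.
Proof.
have [Y XE] := coboundary_split X.
exists (`|word_trace U Pi w Y| + (1 + sqhsnorm Y) *
  \sum_i \sum_j `|word_trace U Pi w (delta_mx i j)|) => N.
rewrite -linear_sum (sum_iter_channel _ XE) linearD/= linearMn/=.
rewrite -[_%:M]scalemx1 linearZ/= addrC addKr linearB/=.
rewrite (le_trans (ler_normB _ _))// lerD2l.
rewrite (le_trans (linear_form_bound _ _))// ler_wpM2r//.
  by do 2![apply: sumr_ge0 => ? _]; rewrite normr_ge0.
by rewrite lerD2l sqhsnorm_iter_channel.
Qed.

End MeanErgodic.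

(** * Convergence on a generating pi-system *)

Section PiSystem.
Local Open Scope classical_set_scope.
Context d (T : measurableType d) (R : realType) (P : probability T R).
Implicit Types (E F : set T).
Local Notation p E := (fine (P E)).

Lemma probability_fineK E : measurable E -> (p E)%:E = P E.
Proof. by move=> mE; rewrite fineK// fin_num_measure. Qed.

Lemma fine_probability_ge0 E : 0 <= p E.
Proof. by rewrite fine_ge0. Qed.

Lemma le_fine_probability E F :
  measurable E -> measurable F -> E `<=` F -> p E <= p F.
Proof.
move=> mE mF EF; rewrite -lee_fin !probability_fineK//.
by apply: le_measure => //; rewrite inE.
Qed.

Lemma fine_probabilityDI E F : measurable E -> measurable F ->
  p E = p (E `\` F) + p (E `&` F).
Proof.
move=> mE mF; apply: EFin_inj; rewrite EFinD !probability_fineK//.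
- exact: measureDI.
- exact: measurableI.
- exact: measurableD.
Qed.

Lemma fine_probability_setD E F : measurable E -> measurable F -> F `<=` E ->
  p (E `\` F) = p E - p F.
Proof.
by move=> mE mF FE; rewrite (fine_probabilityDI mE mF) setIidr// addrK.
Qed.

Lemma fine_probability_nondecreasing_cvg (F : (set T)^nat) :
  (forall n, measurable (F n)) -> nondecreasing_seq F ->
  p (F n) @[n --> \oo] --> p (\bigcup_n F n).
Proof.
move=> mF ndF; have mU : measurable (\bigcup_n F n) by exact: bigcup_measurable.
apply: fine_cvg; rewrite probability_fineK//; exact: nondecreasing_cvg_mu.
Qed.

Lemma fine_probability_nonincreasing_cvg (F : (set T)^nat) :
  (forall n, measurable (F n)) -> nonincreasing_seq F ->
  p (F n) @[n --> \oo] --> p (\bigcap_n F n).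
Proof.
move=> mF niF; have mI : measurable (\bigcap_n F n) by exact: bigcap_measurable.
apply: fine_cvg; rewrite probability_fineK//; apply: nonincreasing_cvg_mu => //.
by rewrite ltey_eq fin_num_measure.
Qed.

(** The functionals q n are only required to be dominated by P, uniformly in n:
domination is what allows the limit in n to be exchanged with an increasing
union of events.  The events where convergence holds then form a lambda-system,
and the pi-lambda theorem applies. *)
Lemma pi_system_cvg (G : set (set T)) (q : nat -> set T -> R) (c : R) :
  @measurable _ T = <<s G >> -> setI_closed G -> G setT ->
  (forall n E F, measurable E -> measurable F -> F `<=` E ->
     q n (E `\` F) = q n E - q n F) ->
  (forall n E, measurable E -> 0 <= q n E <= p E) ->
  (forall E, G E -> q n E @[n --> \oo] --> c * p E) ->
  forall E, measurable E -> q n E @[n --> \oo] --> c * p E.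
Proof.
move=> mG GI GT qB q_bnd qG.
suff : <<s G >> `<=`
    [set E | measurable E /\ q n E @[n --> \oo] --> c * p E].
  by rewrite -mG => H E /H[].
apply: lambda_system_subset => //; last first.
  by move=> E GE; split; [rewrite mG; exact: sub_gen_smallest|exact: qG].
split=> //.
- by split=> //; exact: qG.
- move=> E F FE [mE qE] [mF qF]; split; first exact: measurableD.
  rewrite fine_probability_setD// mulrBr.
  under eq_cvg do rewrite qB//.
  exact: cvgB.
move=> F ndF HF; have mF n : measurable (F n) by have [] := HF n.
have mU : measurable (\bigcup_n F n) by exact: bigcup_measurable.
split=> //; set E := \bigcup_n F n.
have FE m : F m `<=` E by exact: bigcup_sup.
apply/cvgrPdist_lt => e e0.
have e3 : 0 < e / 3 by rewrite divr_gt0.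
have c1 : 0 < `|c| + 1 by rewrite ltr_wpDl.
have := fine_probability_nondecreasing_cvg mF ndF.
move=> /cvgrPdist_lt/(_ (e / 3 / (`|c| + 1))) => /(_ (divr_gt0 e3 c1)).
have := fine_probability_nondecreasing_cvg mF ndF.
move=> /cvgrPdist_lt/(_ _ e3) => H1 H2.
(* The event F m is close to E for P, hence also for q n whatever n is. *)
near \oo => m.
have pm1 : `|p E - p (F m)| < e / 3 by near: m; exact: H1.
have pm2 : `|p E - p (F m)| < e / 3 / (`|c| + 1) by near: m; exact: H2.
have [_ /cvgrPdist_lt/(_ _ e3) qm] := HF m.
near=> n.
have qmn : `|c * p (F m) - q n (F m)| < e / 3 by near: n; exact: qm.
rewrite (_ : _ - _ = c * (p E - p (F m)) + (c * p (F m) - q n (F m))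
   - (q n E - q n (F m))); last by rewrite mulrBr addrA subrK opprB addrA subrK.
have qEF : `|q n E - q n (F m)| < e / 3.
  rewrite -qB//; have /andP[q0 qp] := q_bnd n _ (measurableD mU (mF m)).
  rewrite ger0_norm// (le_lt_trans qp)// fine_probability_setD//.
  by rewrite (le_lt_trans (ler_norm _)).
have cEF : `|c * (p E - p (F m))| < e / 3.
  rewrite normrM; apply: (@le_lt_trans _ _ ((`|c| + 1) * `|p E - p (F m)|)).
    by rewrite ler_wpM2r// lerDl.
  by rewrite mulrC -ltr_pdivlMr.
rewrite (le_lt_trans (ler_normB _ _))//.
have := ler_normD (c * (p E - p (F m))) (c * p (F m) - q n (F m)).
by lra.
Unshelve. all: by end_near. Qed.

End PiSystem.

(** * A criterion for ergodicity *)

Section Ergodicity.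
Local Open Scope classical_set_scope.
Context d (T : measurableType d) (R : realType) (P : probability T R).
Implicit Types (A B E F : set T).
Local Notation p E := (fine (P E)).

Lemma preimage_iterS (f : T -> T) n E :
  iter n.+1 f @^-1` E = f @^-1` (iter n f @^-1` E).
Proof. by apply/seteqP; split=> x; rewrite /preimage/= -iterS iterSr. Qed.

Lemma iter_measure_preserving (f : T -> T) n E :
  (forall F, measurable F -> measurable (f @^-1` F) /\ P (f @^-1` F) = P F) ->
  measurable E ->
  measurable (iter n f @^-1` E) /\ P (iter n f @^-1` E) = P E.
Proof.
move=> fP mE; elim: n => [//|n [mfE PfE]].
by rewrite preimage_iterS; have [? ->] := fP _ mfE.
Qed.

Lemma arithmetic_mean_cvg (a : R^nat) (l K : R) :
  (forall N, `|\sum_(j < N) a j - l *+ N| <= K) ->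
  arithmetic_mean a @ \oo --> l.
Proof.
move=> aK; apply/cvgrPdist_le => e e0.
have K0 : 0 <= K := le_trans (normr_ge0 _) (aK 0%N).
near=> n; rewrite /arithmetic_mean/= seriesEord/=.
have n0 : 0 < n.+1%:R :> R by [].
rewrite -(ler_pM2l n0) -{1}(gtr0_norm n0) -normrM mulrBr mulVKf ?gt_eqF//.
rewrite distrC mulr_natl (le_trans (aK _))// -ler_pdivrMr//.
apply: (@le_trans _ _ n%:R); last by rewrite ler_nat.
near: n; exact: (nbhs_infty_ger (K / e)).
Unshelve. all: by end_near. Qed.

(** Mixing in mean extends from the events E of the pi-system to all events by
[pi_system_cvg], the domination coming from the invariance of P.  For an
invariant event A the means are constant, so A is independent of each B in the
pi-system, hence of every event by [pi_system_cvg] again, in particular of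
itself.  The delay m may depend on B: an invariant event does not see it. *)
Theorem ergodic_of_mixing_in_mean (f : T -> T) (G : set (set T)) :
  @measurable _ T = <<s G >> -> setI_closed G -> G setT ->
  (forall E, measurable E -> measurable (f @^-1` E) /\ P (f @^-1` E) = P E) ->
  (forall B, G B -> exists m, forall E, G E ->
     arithmetic_mean (fun j => p (B `&` iter (m + j) f @^-1` E)) @ \oo
       --> p B * p E) ->
  ergodic f P.
Proof.
move=> mG GI GT fP mix A mA fA.
have fnP n E := @iter_measure_preserving f n E fP.
have fnA n : iter n f @^-1` A = A.
  by elim: n => [//|n IHn]; rewrite preimage_iterS IHn.
have GM B : G B -> measurable B by rewrite mG => GB; exact: sub_gen_smallest.
have indepG B : G B -> p (B `&` A) = p B * p A.
  move=> GB; have [m mixB] := mix B GB; have mB := GM B GB.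
  have mBf j E : measurable E -> measurable (B `&` iter (m + j) f @^-1` E).
    by move=> mE; apply: measurableI => //; exact: (fnP _ _ mE).1.
  pose q n E := arithmetic_mean (fun j => p (B `&` iter (m + j) f @^-1` E)) n.
  have qE n E : q n E =
      n.+1%:R^-1 * \sum_(j < n.+1) p (B `&` iter (m + j) f @^-1` E).
    by rewrite /q /arithmetic_mean/= seriesEord.
  have : q n A @[n --> \oo] --> p B * p A.
    apply: (@pi_system_cvg _ _ _ P G q) => //.
    - move=> n E F mE mF FE; rewrite !qE -mulrBr -sumrB; congr (_ * _).
      apply: eq_bigr => j _; rewrite -fine_probability_setD; last 1 first.
      + by apply: setIS; exact: preimage_subset.
      + by congr (fine (P _)); apply/seteqP; split=> x /=; tauto.
      + exact: mBf.
      + exact: mBf.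
    - move=> n E mE; rewrite qE; apply/andP; split.
        by rewrite mulr_ge0// sumr_ge0// => j _; exact: fine_probability_ge0.
      rewrite mulrC ler_pdivrMr// mulr_natr.
      rewrite -[n.+1 in leRHS]card_ord -sumr_const.
      apply: ler_sum => j _; have [mfE PfE] := fnP (m + j)%N E mE.
      by rewrite -PfE; apply: le_fine_probability => //; exact: mBf.
    have -> : (fun n => q n A) = fun=> p (B `&` A).
      apply/funext => n; rewrite qE; under eq_bigr do rewrite fnA.
      by rewrite sumr_const card_ord -[fine _ *+ _]mulr_natl mulKf.
    by move=> /(cvg_unique _ (cvg_cst _)) ->.
have indep E : measurable E -> p (E `&` A) = p A * p E.
  move=> mE; have : p (E `&` A) @[n --> \oo] --> p A * p E.
    apply: (@pi_system_cvg _ _ _ P G (fun _ E => p (E `&` A))) => //.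
    - move=> _ B F mB mF FE; rewrite -fine_probability_setD.
      + by congr (fine (P _)); apply/seteqP; split=> x /=; tauto.
      + exact: measurableI.
      + exact: measurableI.
      + exact: setSI.
    - move=> _ B mB; rewrite fine_probability_ge0.
      by apply: le_fine_probability => //; exact: measurableI.
    - by move=> B GB; rewrite indepG// mulrC; exact: cvg_cst.
  by move=> /(cvg_unique _ (cvg_cst _)) ->.
have := indep A mA; rewrite setIid => /eqP.
rewrite -subr_eq0 -{1}[p A]mulr1 -mulrBr mulf_eq0 subr_eq0 => /orP[]/eqP pA.
  by left; rewrite -(probability_fineK P mA) pA.
by right; rewrite -(probability_fineK P mA) -pA.
Qed.

End Ergodicity.

(** * Cylinders and the shift *)

Section PathSpace.
Local Open Scope classical_set_scope.
Implicit Types (u w : seq 'I_2) (s : path_space).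

Lemma cylinder_nil : cylinder [::] = setT.
Proof. by apply/seteqP; split. Qed.

(** The empty set is added because two cylinders may be disjoint. *)
Definition cylinders : set (set path_space) := range cylinder `|` [set set0].

Lemma measurable_cylindersE : @measurable _ path_space = <<s cylinders >>.
Proof.
apply/seteqP; split; apply: smallest_sub.
- exact: smallest_sigma_algebra.
- by move=> B cB; apply: sub_gen_smallest; left.
- exact: smallest_sigma_algebra.
- by move=> B [cB| ->]; [exact: sub_gen_smallest|exact: sigma_algebra0].
Qed.

Lemma measurable_cylinder w : measurable (cylinder w : set path_space).
Proof. by apply: sub_gen_smallest; exists w. Qed.

Lemma sub_cylinder u w s : (size u <= size w)%N ->
  cylinder u s -> cylinder w s -> cylinder w `<=` cylinder u.
Proof.
move=> uw us ws t wt k ku; have kw := leq_trans ku uw.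
by rewrite wt// -ws// us.
Qed.

Lemma cylinders_setI_closed : setI_closed cylinders.
Proof.
move=> _ _ [[u _ <-]|->] [[w _ <-]|->]; rewrite ?(setI0, set0I); try by right.
have [->|/set0P[s [us ws]]] := eqVneq (cylinder u `&` cylinder w) set0.
  by right.
left; have [uw|/ltnW wu] := leqP (size u) (size w).
  by exists w => //; rewrite setIidr//; exact: sub_cylinder uw us ws.
by exists u => //; rewrite setIidl//; exact: sub_cylinder wu ws us.
Qed.

Lemma iter_left_shift n s : iter n left_shift s = fun k => s (n + k)%N.
Proof.
elim: n => [//|n IHn]; rewrite iterS IHn.
by apply/funext => k; rewrite /left_shift addnS addSn.
Qed.

Lemma cylinder_cat u w :
  cylinder u `&` iter (size u) left_shift @^-1` cylinder w = cylinder (u ++ w).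
Proof.
apply/seteqP; split=> s; rewrite /cylinder/preimage/=.
  move=> [us ws] k; rewrite size_cat nth_cat.
  case: (ltnP k (size u)) => [ku _|uk kw]; first exact: us.
  have := ws (k - size u)%N.
  by rewrite iter_left_shift subnKC// ltn_subLR//; exact.
move=> h; split=> k kl; first by rewrite h ?size_cat ?ltn_addr// nth_cat kl.
rewrite iter_left_shift h ?size_cat ?ltn_add2l// nth_cat.
by rewrite ltnNge leq_addr/= addKn.
Qed.

Lemma cylinder_rcons u k s :
  cylinder (rcons u k) s <-> cylinder u s /\ s (size u) = k.
Proof.
rewrite /cylinder/= size_rcons; split=> [h|[us <-] j].
  split=> [j ju|]; first by rewrite h ?nth_rcons ?ju// ltnW.
  by rewrite h// nth_rcons ltnn eqxx.
rewrite ltnS leq_eqVlt nth_rcons => /orP[/eqP ->|ju].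
  by rewrite ltnn eqxx.
by rewrite ju us.
Qed.

Lemma measurable_preimage_left_shift (E : set path_space) :
  measurable E -> measurable (left_shift @^-1` E).
Proof.
move=> mE; rewrite -[_ @^-1` _]setTI.
suff : measurable_fun setT left_shift by exact.
apply: (@measurability _ _ path_space path_space setT left_shift
  (range cylinder)) => //.
move=> _ [_ [w _ <-] <-]; rewrite setTI.
rewrite [X in measurable X](_ : _ = cylinder (0 :: w) `|` cylinder (1 :: w)).
  by apply: measurableU; exact: measurable_cylinder.
have cylE k s : cylinder (k :: w) s <->
    s 0%N = k /\ (left_shift @^-1` cylinder w) s.
  have := cylinder_cat [:: k] w => /seteqP[ab ba].
  split=> [/ba[+ ws]|[sk ws]].
    by move=> /(_ 0%N isT) sk.
  by apply: ab; split=> // -[|//] _.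
apply/seteqP; split=> s.
  by move=> ws; have [s0|s1] := letterP (s 0%N); [left|right]; apply/cylE.
by move=> [|] /cylE[].
Qed.

Lemma measurable_iter_left_shift n (E : set path_space) :
  measurable E -> measurable (iter n left_shift @^-1` E).
Proof.
move=> mE; elim: n => [//|n mnE].
by rewrite preimage_iterS; exact: measurable_preimage_left_shift.
Qed.

End PathSpace.

(** * Irreducibility implies ergodicity of the Kusuoka measure *)

Section Kusuoka.
Local Open Scope classical_set_scope.
Variables (R : realType) (d : nat) (U : 'M[R[i]]_d) (Pi : 'I_2 -> 'M[R[i]]_d)
  (P : probability path_space R).
Hypotheses (d_gt0 : (0 < d)%N) (uU : U \is unitarymx) (pvm : is_PVM Pi).
Hypothesis kusuoka : is_Kusuoka_measure U Pi P.
Local Notation Phi := (channel U Pi).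
Local Notation rho := (rho_star R d).
Local Notation p E := (fine (P E)).
Local Notation after u := (foldl (fun Y k => kraus U Pi k Y) rho u).

Lemma natd_neq0 : d%:R != 0 :> R[i].
Proof. by rewrite pnatr_eq0 -lt0n. Qed.

Lemma mxtrace_rho_star : \tr rho = 1.
Proof. by rewrite /rho_star linearZ/= mxtrace1 mulVf// natd_neq0. Qed.

Lemma channel_rho_star : Phi rho = rho.
Proof.
rewrite /rho_star linearZ/= channel1//; [exact: pvm_idem|exact: pvm_sum].
Qed.

(** The empty word is included: both sides are then 1. *)
Lemma kusuoka_cylinder w : (p (cylinder w))%:C%C = word_trace U Pi w rho.
Proof.
case: w => [|k w]; last exact: kusuoka.
by rewrite cylinder_nil probability_setT/= /word_trace/= mxtrace_rho_star.
Qed.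

Lemma mxtrace_after u : \tr (after u) = (p (cylinder u))%:C%C.
Proof. by rewrite kusuoka_cylinder. Qed.

(** Summing over the letter read just after u turns the state after u into its
image under Phi and shortens the gap by one. *)
Lemma kusuoka_cylinder_shift u w j :
  (p (cylinder u `&` iter (size u + j) left_shift @^-1` cylinder w))%:C%C =
  word_trace U Pi w (iter j Phi (after u)).
Proof.
elim: j u => [|j IHj] u.
  rewrite addn0 cylinder_cat kusuoka_cylinder; exact: word_trace_cat.
set E := iter _ _ @^-1` _.
have mE : measurable E.
  by apply: measurable_iter_left_shift; exact: measurable_cylinder.
have mu v := measurable_cylinder v.
have EE k : E = iter (size (rcons u k) + j) left_shift @^-1` cylinder w.
  by rewrite size_rcons addSnnS.
rewrite (fine_probabilityDI P (measurableI _ _ (mu u) mE) (mu (rcons u 0))).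
rewrite (_ : _ `\` _ = cylinder (rcons u 1) `&` E); last first.
  apply/seteqP; split=> s.
    move=> [[us Es] nus]; split=> //; apply/cylinder_rcons; split=> //.
    have [s0|//] := letterP (s (size u)).
    by case: nus; apply/cylinder_rcons; split.
  move=> [/cylinder_rcons[us s1] Es]; split=> // /cylinder_rcons[_].
  by rewrite s1.
rewrite (_ : cylinder u `&` _ `&` _ = cylinder (rcons u 0) `&` E); last first.
  apply/seteqP; split=> s.
    by move=> [[us Es] u0s].
  by move=> [u0s Es]; split=> //; split=> //; have /cylinder_rcons[] := u0s.
rewrite rmorphD/= {1}(EE 1) (EE 0) !IHj !foldl_rcons -iterS iterSr addrC.
by rewrite -linearD/= -iter_channelD.
Qed.

(** On cylinders this is the invariance of the maximally mixed state under Phi,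
and a probability is determined by its values on cylinders. *)
Lemma left_shift_preserving (E : set path_space) :
  measurable E -> P (left_shift @^-1` E) = P E.
Proof.
move=> mE; have mT : measurable_fun setT left_shift.
  by move=> _ F mF; rewrite setTI; exact: measurable_preimage_left_shift.
have P_cyl w : P (left_shift @^-1` cylinder w) = P (cylinder w).
  have mw := measurable_cylinder w.
  rewrite -(probability_fineK P mw).
  rewrite -(probability_fineK P (measurable_preimage_left_shift mw)).
  congr _%:E; apply: complexI.
  have /= := kusuoka_cylinder_shift [::] w 1.
  by rewrite cylinder_nil setTI channel_rho_star kusuoka_cylinder.
apply: (@measure_unique _ _ _ cylinders (fun=> setT) _ _ _ _
  (pushforward P left_shift)) => //.
- exact: measurable_cylindersE.
- exact: cylinders_setI_closed.
- by move=> _; left; exists [::] => //; exact: cylinder_nil.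
- by rewrite bigcup_const.
- by move=> _ [[w _ <-]| ->]; [exact: P_cyl|rewrite !measure0].
- by move=> _; rewrite /= /pushforward preimage_setT probability_setT ltry.
Qed.

Lemma left_shift_measure_preserving (E : set path_space) : measurable E ->
  measurable (left_shift @^-1` E) /\ P (left_shift @^-1` E) = P E.
Proof.
move=> mE; split; last exact: left_shift_preserving.
exact: measurable_preimage_left_shift.
Qed.

Lemma kusuoka_ergodic : irreducible_pair U (Pi 1) -> ergodic left_shift P.
Proof.
move=> irr.
apply: (@ergodic_of_mixing_in_mean _ _ _ _ _ cylinders).
- exact: measurable_cylindersE.
- exact: cylinders_setI_closed.
- by left; exists [::] => //; exact: cylinder_nil.
- exact: left_shift_measure_preserving.
move=> _ [[u _ <-]| ->]; last first.
  exists 0%N => E _; rewrite measure0 mul0r.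
  apply: (@arithmetic_mean_cvg _ _ _ 0) => N.
  by rewrite big1 ?mul0rn ?subrr ?normr0// => j _; rewrite set0I measure0.
exists (size u) => _ [[w _ <-]| ->]; last first.
  rewrite measure0 mulr0; apply: (@arithmetic_mean_cvg _ _ _ 0) => N.
  rewrite big1 ?mul0rn ?subrr ?normr0// => j _.
  by rewrite preimage_set0 setI0 measure0.
have [K HK] := word_trace_mean_bound d_gt0 uU (pvm_adjoint pvm) (pvm_idem pvm)
  (pvm_sum pvm) irr w (after u).
apply: (@arithmetic_mean_cvg _ _ _ (complex.Re K)) => N.
rewrite -lecR.
(* The bound K is a complex number, but it dominates an absolute value. *)
have KR : (complex.Re K)%:C%C = K.
  by apply: RRe_real; apply: ger0_real; exact: le_trans (HK 0%N).
rewrite KR; apply: le_trans (HK N).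
rewrite le_eqVlt; apply/orP; left; apply/eqP.
have normRC (x : R) : `|x%:C%C| = `|x|%:C%C.
  by rewrite normc_def/= expr0n/= addr0 sqrtr_sqr.
rewrite -normRC rmorphB/= rmorphMn/= rmorphM/= raddf_sum/=.
under eq_bigr do rewrite kusuoka_cylinder_shift.
congr `|_ - _ *+ N|.
rewrite -mxtrace_after -mulrA; congr (_ * _).
by rewrite kusuoka_cylinder /rho_star linearZ.
Qed.

End Kusuoka.

(** * An eigenvector with a constant letter prevents ergodicity *)

Section FixedLine.
Local Open Scope sesquilinear_scope.
Variables (C : numClosedFieldType) (d : nat).
Variables (U : 'M[C]_d) (Pi : 'I_2 -> 'M[C]_d).
Hypotheses (uU : U \is unitarymx).
Hypotheses (Pi_adj : forall k, (Pi k)^t* = Pi k).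

Lemma kraus_mulmx_adj k n (B : 'M[C]_(d, n)) :
  kraus U Pi k (B *m B^t*) = (Pi k *m U *m B) *m (Pi k *m U *m B)^t*.
Proof. by rewrite /kraus !adjmxM Pi_adj !mulmxA. Qed.

(** Each step preserves the shape B B^*, so positive states remain positive. *)
Lemma word_trace_ge0 w n (B : 'M[C]_(d, n)) :
  0 <= word_trace U Pi w (B *m B^t*).
Proof.
rewrite /word_trace; elim: w n B => [|k w IHw] n B; first exact: sqhsnorm_ge0.
by rewrite /= kraus_mulmx_adj.
Qed.

(** The projection Q onto the line of v is fixed by the step with outcome k, so
it keeps its trace 1 whatever the length of the word; the remainder 1 - Q is a
positive matrix and contributes a nonnegative amount. *)
Lemma word_trace_nseq_ge1 k a (v : 'cV[C]_d) n : v != 0 ->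
  U *m v = a *: v -> Pi k *m v = v -> 1 <= word_trace U Pi (nseq n k) 1%:M.
Proof.
move=> v0 Uv Pv; set N := sqhsnorm v.
have N0 : N != 0 by apply: contra v0 => /eqP/sqhsnorm_eq0/eqP.
have NE : v^t* *m v = N%:M by rewrite [LHS]mx11_scalar -trace_mx11 mxtrace_mulC.
have Nr : N^* = N by apply: conj_Creal; rewrite ger0_real// sqhsnorm_ge0.
(* U is an isometry. *)
have aa : a * a^* = 1.
  apply: (mulIf N0); rewrite mul1r -[RHS](sqhsnorm_unitaryl v uU) Uv.
  by rewrite /sqhsnorm adjmxZ -scalemxAl -scalemxAr scalerA linearZ.
pose Q := N^-1 *: (v *m v^t*).
have krausQ : kraus U Pi k Q = Q.
  rewrite /Q linearZ/= kraus_mulmx_adj -[Pi k *m U *m v]mulmxA Uv -scalemxAr Pv.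
  by rewrite adjmxZ -scalemxAl -scalemxAr [a *: (_ *: _)]scalerA aa scale1r.
have QE : word_trace U Pi (nseq n k) Q = 1.
  rewrite /word_trace; elim: n => [|n IHn]; last by rewrite /= krausQ.
  by rewrite /Q /= linearZ/= mulVf.
have Q_adj : Q^t* = Q by rewrite /Q adjmxZ fmorphV/= Nr adjmxM trmxCK.
have Q_idem : Q *m Q = Q.
  rewrite /Q -scalemxAl -scalemxAr mulmxA -[_ *m _ *m v]mulmxA NE.
  by rewrite mul_mx_scalar -scalemxAl [N^-1 *: (N *: _)]scalerA mulVf// scale1r.
have S_psd : 1%:M - Q = (1%:M - Q) *m (1%:M - Q)^t*.
  rewrite adjmxB adjmx1 Q_adj mulmxBl mul1mx mulmxBr mulmx1 Q_idem.
  by rewrite subrr subr0.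
rewrite -[1%:M](subrK Q) linearD/= QE lerDr S_psd.
exact: word_trace_ge0.
Qed.

End FixedLine.

Section NotErgodic.
Local Open Scope classical_set_scope.
Variables (R : realType) (d : nat) (U : 'M[R[i]]_d) (Pi : 'I_2 -> 'M[R[i]]_d)
  (P : probability path_space R).
Hypotheses (d_gt0 : (0 < d)%N) (uU : U \is unitarymx) (pvm : is_PVM Pi).
Hypothesis kusuoka : is_Kusuoka_measure U Pi P.
Local Notation p E := (fine (P E)).

(** P(letter k) is the squared norm of Pi_k U divided by d, and Pi_k U is not
0. *)
Lemma kusuoka_letter_gt0 k : 0 < p (cylinder [:: k]).
Proof.
rewrite lt_neqAle fine_probability_ge0 andbT eq_sym; apply/negP => /eqP pk0.
apply: (pvm_neq0 pvm (i := k)).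
have : sqhsnorm (Pi k *m U) = 0.
  have := kusuoka_cylinder d_gt0 kusuoka [:: k].
  rewrite pk0 /rho_star linearZ/= => /esym/eqP.
  rewrite mulf_eq0 invr_eq0 (negbTE (natd_neq0 R d_gt0))/= => /eqP.
  rewrite -[X in word_trace _ _ _ X](mulmx1 1%:M) -{2}[1%:M]adjmx1.
  by rewrite /word_trace/= kraus_mulmx_adj ?mulmx1//; exact: pvm_adjoint.
move=> /sqhsnorm_eq0 PU0.
by rewrite -[Pi k]mulmx1 -(unitarymxP uU) mulmxA PU0 mul0mx.
Qed.

(** Z is the event that all letters are 0, and A n the event that all letters
from time n on are 0.  The A n increase and, by invariance, have the same
probability as Z; their union is shift-invariant. *)
Lemma fixed_line_not_ergodic a (v : 'cV[R[i]]_d) : v != 0 ->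
  U *m v = a *: v -> Pi 0 *m v = v -> ~ ergodic left_shift P.
Proof.
move=> v0 Uv Pv erg.
pose Z : set path_space := \bigcap_n cylinder (nseq n 0).
pose A n : set path_space := iter n left_shift @^-1` Z.
have ZP s : Z s <-> forall k, s k = 0.
  split=> [Zs k|s0 n _ k]; last by rewrite size_nseq nth_nseq s0 => ->.
  by rewrite (Zs k.+1 I) ?size_nseq// nth_nseq ltnSn.
have AP n s : A n s <-> forall k, s (n + k)%N = 0.
  by rewrite /A/preimage/= iter_left_shift; exact: ZP.
have mZ : measurable Z.
  by apply: bigcapT_measurable => n; exact: measurable_cylinder.
have mA n : measurable (A n) by exact: measurable_iter_left_shift.
have mU : measurable (\bigcup_n A n) by exact: bigcup_measurable.
have pA n : p (A n) = p Z.
  have T_pres := left_shift_measure_preserving d_gt0 uU pvm kusuoka.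
  by have [_ ->] := iter_measure_preserving n T_pres mZ.
have ndA : nondecreasing_seq A.
  apply/nondecreasing_seqP => n; apply/subsetPset => s /AP As.
  by apply/AP => k; rewrite addSnnS.
have pU : p (\bigcup_n A n) = p Z.
  have := @fine_probability_nondecreasing_cvg _ _ _ P _ mA ndA.
  under eq_cvg do rewrite pA.
  by move=> /(cvg_unique _ (cvg_cst _)) ->.
have pZ_gt0 : 0 < p Z.
  apply: (@lt_le_trans _ _ d%:R^-1); first by rewrite invr_gt0 ltr0n.
  have niZ : nonincreasing_seq (fun n => cylinder (nseq n 0) : set path_space).
    apply/nonincreasing_seqP => n; apply/subsetPset => s.
    by rewrite -[n.+1]addn1 nseqD/= cats1 => /cylinder_rcons[].
  have cvZ := @fine_probability_nonincreasing_cvg _ _ _ P _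
    (fun n => measurable_cylinder (nseq n 0)) niZ.
  rewrite -(cvg_lim _ cvZ)//; apply: limr_ge.
    by apply/cvg_ex; exists (p Z).
  apply: nearW => n; rewrite -lecR (kusuoka_cylinder d_gt0 kusuoka).
  rewrite /rho_star linearZ/= fmorphV rmorph_nat ler_peMr ?invr_ge0 ?ler0n//.
  exact: (word_trace_nseq_ge1 uU (pvm_adjoint pvm) _ v0 Uv Pv).
have pZ_lt1 : p Z < 1.
  apply: (@le_lt_trans _ _ (p (~` cylinder [:: 1]))); last first.
    rewrite probability_setC; last exact: measurable_cylinder.
    rewrite -(probability_fineK P (measurable_cylinder [:: 1])) -EFinB/=.
    by rewrite gtrBl kusuoka_letter_gt0.
  apply: le_fine_probability => //.
    by apply: measurableC; exact: measurable_cylinder.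
  by move=> s /ZP s0 /(_ 0%N isT); rewrite s0.
have TU : left_shift @^-1` (\bigcup_n A n) = \bigcup_n A n.
  apply/seteqP; split=> s [n _ /AP As].
    by exists n.+1 => //; apply/AP => k; rewrite addSnnS addnS; exact: As.
  by exists n => //; apply/AP => k; rewrite /left_shift -addnS As.
have := erg _ mU TU; rewrite -(probability_fineK P mU) pU => -[] [pZ].
  by rewrite pZ ltxx in pZ_gt0.
by rewrite pZ ltxx in pZ_lt1.
Qed.

End NotErgodic.

(** * The four conditions *)

Section RankOne.
Local Open Scope sesquilinear_scope.
Variables (R : realType) (d : nat) (Pi : 'I_2 -> 'M[R[i]]_d).
Variable z : 'cV[R[i]]_d.
Hypothesis (pvm : is_PVM Pi).
Hypothesis z_span : <[z]>%VS = limg (mxop (Pi 1)).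
Implicit Types (v : 'cV[R[i]]_d) (V : {vspace 'cV[R[i]]_d}).

Lemma pvm_limgP k v : v \in limg (mxop (Pi k)) <-> Pi k *m v = v.
Proof.
split=> [/memv_imgP[w _ ->]|<-]; first by rewrite lfunE/= mulmxA (pvm_idem pvm).
by rewrite -[X in X \in _](lfunE (mulmx (Pi k))) memv_img// memvf.
Qed.

Lemma line_pvm : Pi 1 *m z = z.
Proof. by apply/pvm_limgP; rewrite -z_span memv_line. Qed.

Lemma pvm1_collinear v : exists c, Pi 1 *m v = c *: z.
Proof.
apply/vlineP; rewrite z_span; apply/pvm_limgP.
by rewrite mulmxA (pvm_idem pvm).
Qed.

Lemma pvm1_orth v : v^t* *m z = 0 <-> Pi 1 *m v = 0.
Proof.
split=> [vz|Pv]; last first.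
  rewrite -line_pvm -{1}(pvm_adjoint pvm) mulmxA -adjmxM Pv.
  by rewrite linear0 map_mx0 mul0mx.
have [c Pvc] := pvm1_collinear v; apply: sqhsnorm_eq0.
rewrite /sqhsnorm mxtrace_mulC adjmxM (pvm_adjoint pvm) -mulmxA.
rewrite [Pi 1 *m (_ *m _)]mulmxA (pvm_idem pvm) Pvc.
by rewrite -scalemxAr vz scaler0 linear0.
Qed.

(** Pi_2 maps V into the intersection of V with the line of z.  If z is not in V
this intersection is 0, so Pi_2 vanishes on V. *)
Lemma mem_or_orthov V : op_invariant (Pi 1) V -> z \in V \/ z \in orthov V.
Proof.
move=> /mulmx_invariantP PV.
have [zV|zV] := boolP (z \in V); [by left|right].
apply/orthovP => v vV; apply/pvm1_orth; have [c Pvc] := pvm1_collinear v.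
rewrite Pvc; have [->|c0] := eqVneq c 0; first by rewrite scale0r.
by move: (PV v vV); rewrite Pvc rpredZeq (negbTE c0) (negbTE zV).
Qed.

End RankOne.

Theorem theorem14 (R : realType) (d : nat) (U : 'M[R[i]]_d)
    (Pi : 'I_2 -> 'M[R[i]]_d) (z : 'cV[R[i]]_d)
    (P : probability path_space R) :
  (2 <= d)%N ->
  U \is unitarymx ->
  is_PVM Pi ->
  \rank (Pi 0) = (d - 1)%N ->
  \rank (Pi 1) = 1%N ->
  unit_vector z ->
  <[z]>%VS = limg (mxop (Pi 1)) ->
  is_Kusuoka_measure U Pi P ->
  [<-> ~ ergodic left_shift P;
       exists V : {vspace 'cV[R[i]]_d},
         nontrivial_vspace V /\ op_invariant U V /\ op_invariant (Pi 1) V;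
       exists V : {vspace 'cV[R[i]]_d},
         nontrivial_vspace V /\ op_invariant U V /\ z \in V;
       exists (a : R[i]) (v : 'cV[R[i]]_d),
         v <> 0 /\ U *m v = a *: v /\ v \in limg (mxop (Pi 0))]
  /\ (forall V : {vspace 'cV[R[i]]_d},
        op_invariant U V -> op_invariant (Pi 1) V -> op_invariant (Pi 0) V).
Proof.
move=> d_ge2 uU pvm _ _ _ z_span kusuoka.
have d_gt0 : (0 < d)%N := ltnW d_ge2.
split; last first.
  move=> V _ /mulmx_invariantP PV; apply/mulmx_invariantP => v vV.
  have -> : Pi 0 = 1%:M - Pi 1 by rewrite -(pvm_sum pvm) addrK.
  by rewrite mulmxBl mul1mx memvB// PV.
tfae.
- move=> not_erg; apply: contrapT => no_V; apply: not_erg.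
  apply: (kusuoka_ergodic d_gt0 uU pvm kusuoka) => V UV PV.
  have [->|/eqP V0] := eqVneq V 0%VS; first by left.
  have [->|/eqP VT] := eqVneq V fullv; first by right.
  by case: no_V; exists V.
- move=> [V [[V0 VT] [UV PV]]].
  have [zV|zV] := mem_or_orthov pvm z_span PV.
    by exists V.
  exists (orthov V); split; last by split=> //; exact: orthov_invariant.
  by split; [exact: orthov_neq0|exact: orthov_neqT].
- move=> [V [[V0 VT] [UV zV]]].
  have [a [v [vV v0 Uv]]] :=
    invariant_eigenvector (orthov_neq0 VT) (orthov_invariant uU UV).
  exists a, v; split; first exact/eqP; split=> //.
  apply/(pvm_limgP pvm).
  have Pv : Pi 1 *m v = 0.
    apply/(pvm1_orth pvm z_span); move/orthovP : vV => /(_ z zV) zv.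
    by rewrite -[LHS]trmxCK adjmxM trmxCK zv trmx0 map_mx0.
  by rewrite -[RHS]mul1mx -(pvm_sum pvm) mulmxDl Pv addr0.
- move=> [a [v [/eqP v0 [Uv /(pvm_limgP pvm) Pv]]]].
  exact: (fixed_line_not_ergodic d_gt0 uU pvm kusuoka v0 Uv Pv).
Qed.
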